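(* There exist an absolute constant $k_{0}\ge 2$ and a function $\varepsilon:\mathbb{Z}_{\ge k_0}\to\mathbb{R}$ with $\varepsilon(k)=O\bigl(k^{-0.475}\log k\bigr)$ (so in particular $\varepsilon(k)\to 0$ as $k\to\infty$) such that for all integers $k\ge k_{0}$, \[ \frac{H(k)^{1/k}}{k}\;\ge\;\Bigl(\frac{1}{e}-\varepsilon(k)\Bigr)\frac{k}{\log k}. \]
   Context: All logarithms are natural. For a positive integer $N$, $[N]=\{1,2,\ldots,N\}$. A $k$-term arithmetic progression ($k$-AP) in $[N]$ is a sequence $(a,a+d,\ldots,a+(k-1)d)$ with $a,d\in\mathbb{Z}$, $d\ge 1$, all terms in $[N]$. Given a coloring of $[N]$ (a map from $[N]$ to some finite set of colors), a $k$-AP is monochromatic if all its $k$ terms receive the same color, and rainbow if its $k$ terms receive $k$ pairwise distinct colors. The canonical Ramsey function $H(k)$ is the least $N\ge 1$ such that every coloring of $[N]$ with finitely many colors contains a monochromatic $k$-AP or a rainbow $k$-AP. *)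

(* Defs.v *)
From mathcomp Require Import all_boot.

Set Implicit Arguments.
Unset Strict Implicit.
Unset Printing Implicit Defensive.

(* The progression a, a + d, ..., a + (k - 1) d lies in [N] = {1, ..., N}.
   Taking a in nat instead of the integers loses nothing: for k >= 1 the term
   a itself must lie in [N]. *)
Definition ap_in (N k a d : nat) : Prop :=
  0 < d /\ forall i : 'I_k, 1 <= a + i * d <= N.

(* A coloring of [N] is represented by a map on nat; only its values on [N]
   are ever inspected. *)
Definition monochromatic (C : Type) (c : nat -> C) (k a d : nat) : Prop :=
  forall i j : 'I_k, c (a + i * d) = c (a + j * d).

Definition rainbow (C : Type) (c : nat -> C) (k a d : nat) : Prop :=
  injective (fun i : 'I_k => c (a + i * d)).

Definition canonical_ramsey (k N : nat) : Prop :=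
  forall (C : finType) (c : nat -> C),
  exists a d : nat,
    ap_in N k a d /\ (monochromatic c k a d \/ rainbow c k a d).

(* The graph of the canonical Ramsey function: is_H k N means H(k) = N. *)
Definition is_H (k N : nat) : Prop :=
  [/\ 1 <= N, canonical_ramsey k N
    & forall M : nat, 1 <= M -> canonical_ramsey k M -> N <= M].

(* Main.v *)
Require Import Defs.
From mathcomp Require Import all_boot all_order all_algebra.
From mathcomp Require Import ring lra zify.

(* Write integers below p^L in base p, where p is a prime with p <= k < 8 p and
   L = 4 k.  If p^t exactly divides d, the first p terms of a progression of
   difference d share their digits below t, and their t-th digits run through
   all residues.  Hence, if an integer could be coloured by a digit absent from
   its expansion, no progression would be monochromatic.  To cover integers
   using every digit, a fresh palette (disjoint copy of a fixed set of about p/4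
   digits) is opened every p/8 positions; a colour of palette i is available as
   long as its digit has not occurred since palette i was opened, and an integer
   takes a colour from the first palette with a colour left at the end.

   At position t let i be the first palette with more than b ~ p/2000 colours
   left.  Fewer than p/2 colours are left in the palettes up to i, and each one
   is lost at one of the p terms.  So a monochromatic or rainbow progression
   needs at least p/2 terms whose higher digits exhaust palette i.  After adding
   to each digit a random shift depending on the lower digits, the higher digits
   of the p terms are independent and uniform, so this has probability at most
   2^p (1 - c)^(b p / 2), and a union bound over the p^(2 L) progressions gives
   H(k) > p^L >= k^(2 k), which is stronger than the claim: eps = 0 works. *)

Set Implicit Arguments.
Unset Strict Implicit.
Unset Printing Implicit Defensive.

Import Order.TTheory GRing.Theory Num.Theory.

(** * Chebyshev-type estimates: a prime in (k/8, k] *)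

Lemma bin_le_exp2 n m : 'C(n, m) <= 2 ^ n.
Proof.
rewrite -[2]/(1 + 1) expnDn.
case: (leqP m n) => [lemn|/bin_small->//].
have ltm : m < n.+1 by [].
rewrite (bigD1 (Ordinal ltm)) //= !exp1n !muln1; exact: leq_addr.
Qed.

Lemma exp4_le_central_bin n : 0 < n -> 4 ^ n <= n.*2 * 'C(n.*2, n).
Proof.
move=> n0.
have E m : m.+1 * 'C(m.+1.*2, m.+1) = m.*2.+1.*2 * 'C(m.*2, m).
  have h1 := mul_bin_diag m.*2.+1 m.
  have h2 := mul_bin_down m.*2.+1 m.
  rewrite doubleS.
  have e : m.*2.+1 - m = m.+1 by lia.
  rewrite e /= in h2.
  have h3 : 'C(m.*2.+1, m) = 'C(m.*2.+1, m.+1).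
    by rewrite -(bin_sub (_ : m <= m.*2.+1)) ?e //; lia.
  have h4 := binS m.*2.+1 m; nia.
elim: n n0 => // -[|n] IH _; first by [].
have := IH isT; have := E n.+1; rewrite [4 ^ n.+2]expnS.
move: (4 ^ n.+1) 'C(_, _) 'C(_, _) => u v w; nia.
Qed.

Lemma logn_central_bin p n : prime p ->
  logn p 'C(n.*2, n) = \sum_(1 <= i < n.*2.+1) (n.*2 %/ p ^ i - (n %/ p ^ i).*2).
Proof.
move=> pp.
have := bin_fact (_ : n <= n.*2); rewrite -addnn leq_addr addnK => /(_ isT) E.
have := congr1 (logn p) E; rewrite addnn !lognM ?muln_gt0 ?fact_gt0 ?bin_gt0 -?addnn ?leq_addr //.
rewrite !logn_fact // addnn.
have -> : \sum_(1 <= k < n.+1) n %/ p ^ k = \sum_(1 <= k < n.*2.+1) n %/ p ^ k.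
  rewrite [RHS](@big_cat_nat _ _ _ n.+1) //=; last lia.
  rewrite [X in _ + X]big_nat_cond [X in _ + X]big1 ?addn0 // => i /andP[/andP[h _] _].
  by rewrite divn_small // (leq_trans _ (ltn_expl _ (prime_gt1 pp))) // ltnW.
move=> h; rewrite sumnB; last first.
  move=> i _; rewrite -mul2n mulnC leq_divRL ?expn_gt0 ?prime_gt0 //.
  rewrite mulnAC -(muln2 n) leq_pmul2r //; exact: leq_divM.
have -> : \sum_(1 <= i < n.*2.+1) (n %/ p ^ i).*2 =
    \sum_(1 <= i < n.*2.+1) n %/ p ^ i + \sum_(1 <= i < n.*2.+1) n %/ p ^ i.
  by rewrite -big_split; apply: eq_bigr => i _; rewrite -addnn.
by rewrite -h addnK.
Qed.

(** By Legendre's formula each [p ^ i] contributes at most 1 to the valuation, and nothing once it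
    exceeds 2n. *)
Lemma pfactor_central_bin p n : prime p -> 0 < n ->
  p ^ logn p 'C(n.*2, n) <= n.*2.
Proof.
move=> pp n0; have p1 := prime_gt1 pp.
have le_log : logn p 'C(n.*2, n) <= trunc_log p n.*2.
  rewrite logn_central_bin // (@big_cat_nat _ _ _ (trunc_log p n.*2).+1) //=; last first.
    by rewrite ltnS (leq_trans (ltnW (ltn_expl _ p1))) // trunc_logP // double_gt0.
  rewrite [X in _ + X]big_nat_cond [X in _ + X]big1 ?addn0
    => [|i /andP[/andP[h _] _]]; last first.
    rewrite divn_small // (leq_trans (trunc_log_ltn _ p1)) // leq_exp2l //.
  apply: (@leq_trans (\sum_(1 <= i < (trunc_log p n.*2).+1) 1)); last first.
    by rewrite sum_nat_const_nat muln1 subn1.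
  apply: leq_sum => i _.
  have q0 : 0 < p ^ i by rewrite expn_gt0 prime_gt0.
  rewrite -(mul2n n) leq_subLR addn1 -ltnS.
  have := ltn_ceil n q0; rewrite -ltn_divLR //.
  by have := leq_divM (2 * n) (p ^ i); have := ltn_ceil n q0; nia.
apply: leq_trans (trunc_logP p1 _); last by rewrite double_gt0.
by rewrite leq_exp2l.
Qed.

Definition primorial n := \prod_(1 <= p < n.+1 | prime p) p.

Lemma primorial_gt0 n : 0 < primorial n.
Proof. by rewrite prodn_cond_gt0 // => p /prime_gt0. Qed.

Lemma central_bin_prod n : 0 < n ->
  'C(n.*2, n) = \prod_(1 <= p < n.*2.+1 | prime p) p ^ logn p 'C(n.*2, n).
Proof.
move=> n0; set K := 'C(_, _).
have K0 : 0 < K by rewrite bin_gt0 -addnn leq_addr.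
have l0 : logn 0 K = 0 by rewrite lognE.
have logn_big p : n.*2 < p -> logn p K = 0.
  case: (boolP (prime p)) => [pp ltp|/negPf pp _]; last by rewrite lognE pp.
  apply/eqP; rewrite -leqn0 leqNgt; apply/negP => lp.
  have := pfactor_central_bin pp n0; rewrite leqNgt => /negP; apply.
  by apply: leq_trans ltp _; rewrite -{1}[p]expn1 leq_exp2l // prime_gt1.
rewrite -[LHS]partnT // (@widen_partn (n.*2 + K)) ?leq_addl //.
rewrite (@big_cat_nat _ _ _ n.*2.+1) //=; last by rewrite ltnS leq_addr.
rewrite [X in _ * X]big_nat_cond [X in _ * X]big1 => [|p /andP[/andP[h _] _]]; last first.
  by rewrite logn_big.
rewrite muln1 big_ltn_cond //= l0 expn0 mul1n [RHS]big_mkcond /=.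
apply: eq_big_nat => p _; case: ifP => //= /negbT pp.
by rewrite lognE (negPf pp).
Qed.

(** Every prime in (n, 2n] divides the central binomial coefficient. *)
Lemma primorial_double n : 0 < n -> primorial n.*2 <= primorial n * 'C(n.*2, n).
Proof.
move=> n0; rewrite {1}/primorial (@big_cat_nat _ _ _ n.+1) //=; last by lia.
rewrite leq_pmul2l ?primorial_gt0 // central_bin_prod //.
rewrite [leqRHS](@big_cat_nat _ _ _ n.+1) //=; last by lia.
rewrite -[leqLHS]mul1n leq_mul //.
  by rewrite prodn_cond_gt0 // => p /prime_gt0 p0; rewrite expn_gt0 p0.
rewrite big_nat_cond [leqRHS]big_nat_cond; apply: leq_prod => p /andP[/andP[h1 h2] pp].
rewrite -{1}[p]expn1 leq_exp2l ?prime_gt1 // logn_central_bin // big_ltn; last by lia.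
rewrite expn1 (divn_small h1) subn0 ltn_addr // divn_gt0 ?prime_gt0 //.
Qed.

Lemma primorial_exp2 i : primorial (2 ^ i) <= 4 ^ (2 ^ i).
Proof.
elim: i => [|i IH]; first by rewrite expn0 /primorial big_ltn_cond // big_geq.
rewrite expnS mul2n; apply: leq_trans (primorial_double _) _; first by rewrite expn_gt0.
rewrite -addnn expnD leq_mul // (leq_trans (bin_le_exp2 _ _)) //.
by rewrite addnn -mul2n expnM.
Qed.

(** Each prime up to [z] contributes a factor at most 2n; a prime above [z] has its square above 2n,
    so it occurs at most once, and it is at most [y]. *)
Lemma central_bin_le n y z : 0 < n -> y <= n.*2 -> z <= n.*2 -> n.*2 < z.+1 ^ 2 ->
    (forall p, prime p -> p <= n.*2 -> p <= y) ->
  'C(n.*2, n) <= n.*2 ^ z * primorial y.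
Proof.
move=> n0 yn zn zn2 small; rewrite central_bin_prod //.
have n20 : 0 < n.*2 by rewrite double_gt0.
apply: (@leq_trans (\prod_(1 <= p < n.*2.+1 | prime p)
   ((if p <= z then n.*2 else 1) * (if p <= y then p else 1)))).
  rewrite big_nat_cond [leqRHS]big_nat_cond; apply: leq_prod => p /andP[/andP[h1 h2] pp].
  have := pfactor_central_bin pp n0; set l := logn _ _ => le_l.
  rewrite (small p) //; case: (leqP p z) => pz.
    by rewrite (leq_trans le_l) // leq_pmulr.
  rewrite mul1n -{2}[p]expn1 leq_exp2l ?prime_gt1 // leqNgt; apply/negP => l2.
  have h3 : p ^ 2 <= p ^ l by rewrite leq_exp2l // (prime_gt1 pp).
  have h4 : z.+1 ^ 2 <= p ^ 2 by rewrite leq_sqr.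
  by move: (leq_trans (leq_trans (leq_trans zn2 h4) h3) le_l); rewrite ltnn.
rewrite big_split /= leq_mul //.
  rewrite (@big_cat_nat _ _ _ z.+1) //= [X in _ * X]big_nat_cond.
  rewrite [X in _ * X]big1 ?muln1 => [|p /andP[/andP[h _] _]]; last first.
    by rewrite leqNgt h.
  apply: (@leq_trans (\prod_(1 <= p < z.+1) n.*2)); last first.
    by rewrite prod_nat_const_nat subn1.
  rewrite big_mkcond big_nat_cond [leqRHS]big_nat_cond; apply: leq_prod => p _.
  by case: ifP => // _; case: ifP.
rewrite (@big_cat_nat _ _ _ y.+1) //= [X in _ * X]big_nat_cond.
rewrite [X in _ * X]big1 ?muln1 => [|p /andP[/andP[h _] _]]; last first.
  by rewrite leqNgt h.
rewrite /primorial big_nat_cond [leqRHS]big_nat_cond; apply: leq_prod => p _.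
by case: ifP => // ; lia.
Qed.

Lemma exp2_gt_linear v : 7 <= v -> 6 * v.+1 < 2 ^ v.
Proof.
elim: v => // v IH; rewrite leq_eqVlt => /orP[/eqP[<-]//|/IH].
rewrite expnS; lia.
Qed.

Lemma exists_prime_between k : 16 <= trunc_log 2 k -> exists2 p, prime p & p <= k < 8 * p.
Proof.
move=> j16; have k0 : 0 < k by case: k j16.
have [l1 l2] := andP (trunc_log_bounds (isT : 1 < 2) k0).
case: (trunc_log 2 k) j16 l1 l2 => // j j15 l1 l2.
(* Here k lies in [2n, 4n), so any prime in (n/2, 2n] will do. *)
pose n := 2 ^ j.
have n0 : 0 < n by rewrite expn_gt0.
have n2 : n.*2 = 2 ^ j.+1 by rewrite expnS mul2n.
have [/existsP[p /andP[pp hp]]|none] := boolP [exists p : 'I_n.*2.+1, prime p && (2 ^ j.-1 < p)].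
  exists (nat_of_ord p) => //; have lp := ltn_ord p.
  move: (nat_of_ord p) pp hp lp => {}p pp hp; rewrite n2 => lp.
  have e : 2 ^ j.+2 = 8 * 2 ^ j.-1 by rewrite -[8]/(2 ^ 3) -expnD; congr (2 ^ _); lia.
  lia.
(* Otherwise all primes up to 2n are at most n/2, whose primorial is at most 2^n. With the cut-off z
   = 2^(v+1), which is at least sqrt(2n), this gives 4^n <= 2n (2n)^z 2^n, contradicting (j+1)(z+1)
   < n. *)
exfalso.
pose v := j./2.
have hj := odd_double_half j.
have v7 : 7 <= v by rewrite /v; lia.
have le1 := exp4_le_central_bin n0.
have le2 : 'C(n.*2, n) <= n.*2 ^ (2 ^ v.+1) * primorial (2 ^ j.-1).
  apply: central_bin_le => //.
  - by rewrite n2 leq_exp2l //; lia.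
  - by rewrite n2 leq_exp2l // /v; lia.
  - apply: (@leq_ltn_trans ((2 ^ v.+1) ^ 2)); last by rewrite ltn_sqr.
    by rewrite n2 -expnM leq_exp2l // /v; lia.
  - move=> p pp lep; rewrite leqNgt; apply: contra none => h.
    have lep' : p < n.*2.+1 by [].
    by apply/existsP; exists (Ordinal lep'); rewrite pp.
have le3 := primorial_exp2 j.-1.
have : 4 ^ n <= 2 ^ j.+1 * (2 ^ (j.+1 * 2 ^ v.+1) * 2 ^ (2 * 2 ^ j.-1)).
  apply: leq_trans le1 _; rewrite {1}n2 leq_mul2l; apply/orP; right.
  apply: leq_trans le2 _; rewrite n2 -expnM leq_mul2l; apply/orP; right.
  by rewrite (leq_trans le3) // -[4]/(2 ^ 2) -expnM.
rewrite -[4]/(2 ^ 2) -expnM -!expnD leq_exp2l // leqNgt => /negP; apply.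
have -> : 2 * 2 ^ j.-1 = n by rewrite -expnS; congr (2 ^ _); lia.
have := exp2_gt_linear v7.
have : 2 ^ v * 2 ^ v <= n by rewrite -expnD /n leq_exp2l //; rewrite /v; lia.
rewrite expnS; move: (2 ^ v) => w.
have : j.+1 <= 2 * v.+1 by rewrite /v; lia.
nia.
Qed.

(** * Colouring digit sequences by palettes *)

Section Palettes.
Variables (F : finType) (L tau m b : nat) (A : {set F}).
Implicit Types (e : 'I_L -> F) (i n : nat).

(** Palette [i] opens at position [i * tau] and ignores earlier digits. All palettes share the set
    [A]; the index stored in [palette_color] makes the copies disjoint. *)
Definition alive i e n : {set F} :=
  [set c in A | [forall s : 'I_L, (i * tau <= s < n) ==> (e s != c)]].

Lemma aliveP i e n c :
  reflect (c \in A /\ forall s : 'I_L, i * tau <= s < n -> e s != c)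
          (c \in alive i e n).
Proof.
rewrite inE; apply: (iffP andP) => -[cA H]; split=> //.
  by move=> s; apply/implyP; move/forallP: H.
by apply/forallP => s; apply/implyP; apply: H.
Qed.

Lemma card_ord_interval lo hi : #|[set s : 'I_L | lo <= s < hi]| <= hi - lo.
Proof.
rewrite cardE -(size_map val) -(size_iota lo (hi - lo)).
apply: uniq_leq_size; first by rewrite (map_inj_uniq val_inj) enum_uniq.
move=> x /mapP[s]; rewrite mem_enum inE => /andP[h1 h2] ->.
by rewrite mem_iota /=; lia.
Qed.

(** Each position read since the opening kills at most one colour. *)
Lemma card_alive i e n u : n <= i * tau + u -> #|A| <= #|alive i e n| + u.
Proof.
move=> le_n; pose I := [set s : 'I_L | i * tau <= s < n].
have sub : A \subset alive i e n :|: [set e s | s in I].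
  apply/subsetP => c cA; rewrite inE; case: (boolP (c \in alive i e n)) => //= cN.
  apply/imsetP; move: cN; rewrite inE cA /= => /forallPn[s].
  by rewrite negb_imply negbK => /andP[h /eqP<-]; exists s; rewrite // inE.
apply: leq_trans (subset_leq_card sub) _.
apply: leq_trans (leq_card_setU _ _) _; rewrite leq_add2l.
apply: leq_trans (leq_imset_card _ _) _.
by apply: leq_trans (card_ord_interval _ _) _; lia.
Qed.

Definition final_palette e := find (fun i => alive i e L != set0) (iota 0 m).

Definition palette_color e : 'I_m.+1 * option F :=
  (inord (final_palette e), [pick c in alive (final_palette e) e L]).

Definition safe_palette e n := find (fun i => b < #|alive i e n|) (iota 0 m).

Definition exhausted (T : {set F}) (t : nat) e : bool :=
  [forall c in T, [exists s : 'I_L, (t < s) && (e s == c)]].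

Hypotheses (L_le : L <= m * tau) (tau_A : tau + b < #|A|).

(** The palette opened last, of index [t %/ tau], has lost at most [tau] colours, so it keeps more
    than [b]; the first such palette comes no later. *)
Lemma safe_palette_le e (t : 'I_L) :
  [/\ safe_palette e t * tau <= t, safe_palette e t < m
    & b < #|alive (safe_palette e t) e t|].
Proof.
have tau0 : 0 < tau by case: (tau) L_le (ltn_ord t); lia.
have ltm : t %/ tau < m by rewrite ltn_divLR //; have := ltn_ord t; lia.
pose P i := b < #|alive i e t|.
have Pt : P (t %/ tau).
  have le_t : t <= t %/ tau * tau + tau.
    by have := ltn_ceil t tau0; rewrite mulSn; lia.
  by have := card_alive e le_t; rewrite /P; lia.
have hasP : has P (iota 0 m).
  by apply/hasP; exists (t %/ tau) => //; rewrite mem_iota.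
have lt_find : find P (iota 0 m) < m by rewrite -[X in _ < X](size_iota 0) -has_find.
split=> //.
  rewrite -leq_divRL // leqNgt; apply/negP => lt.
  by have := before_find 0 lt; rewrite nth_iota // add0n -/(P _) Pt.
by have := nth_find 0 hasP; rewrite nth_iota.
Qed.

Lemma before_safe_palette e n i : i < safe_palette e n -> #|alive i e n| <= b.
Proof.
move=> lt; have := before_find 0 lt; rewrite nth_iota; first by rewrite add0n ltnNge => /negbFE.
by apply: leq_trans lt _; rewrite -[X in _ <= X](size_iota 0) find_size.
Qed.

Lemma final_palette_le e i : i < m -> alive i e L != set0 -> final_palette e <= i.
Proof.
move=> im Hi; rewrite leqNgt; apply/negP => lt.
by have := before_find 0 lt; rewrite nth_iota // add0n Hi.
Qed.

(** The last palette [m.-1] sees at most [tau] positions and keeps a colour, so neither default, [m]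
    from [find] nor [None] from [pick], is ever taken. *)
Lemma palette_colorP e : 0 < m -> exists2 c, c \in alive (final_palette e) e L &
  palette_color e = (inord (final_palette e), Some c).
Proof.
move=> m0; rewrite /palette_color; case: pickP => [c cE|none]; first by exists c.
pose P i := alive i e L != set0.
have hasP : has P (iota 0 m).
  apply/hasP; exists m.-1; first by rewrite mem_iota; lia.
  have le_L : L <= m.-1 * tau + tau by rewrite addnC -mulSn prednK.
  by rewrite /P -card_gt0; have := card_alive e le_L; lia.
have := nth_find 0 hasP; rewrite nth_iota; last by rewrite -[X in _ < X](size_iota 0) -has_find.
by rewrite /P add0n => /set0Pn[c]; rewrite -/(final_palette e) none.
Qed.

Section Terms.
Variables (J : finType) (j0 : J) (e : J -> 'I_L -> F) (t : 'I_L).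
Hypothesis same_prefix : forall j j' (s : 'I_L), s < t -> e j s = e j' s.
Hypothesis all_digits : forall c, exists j, e j t = c.

Let i0 := safe_palette (e j0) t.
Let T0 := alive i0 (e j0) t.

Lemma alive_prefix i j : alive i (e j) L \subset alive i (e j0) t.
Proof.
apply/subsetP => c /aliveP[cA H]; apply/aliveP; split=> // s /andP[h1 h2].
by rewrite (same_prefix j0 j h2); apply: H; rewrite h1 ltn_ord.
Qed.

(** A colour of [T0] that is neither the digit at [t] nor a later digit survives to the end in
    palette [i0]. *)
Lemma final_palette_normal j :
  ~~ exhausted (T0 :\ e j t) t (e j) -> final_palette (e j) <= i0.
Proof.
case: (safe_palette_le (e j0) t) => _ i0m _.
case/forall_inPn => c; rewrite in_setD1 => /andP[ne /aliveP[cA H]] /existsPn unseen.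
apply: final_palette_le => //; apply/set0Pn; exists c; apply/aliveP; split=> // s /andP[h _].
case: (ltngtP s t) => [lt|gt|/val_inj->]; last by rewrite eq_sym.
  by rewrite (same_prefix j j0 lt); apply: H; rewrite h.
by have := unseen s; rewrite gt.
Qed.

(** If a non-exhausted term shared its colour with all terms, the palette would be open at [t], and
    the term whose digit at [t] is that colour would have killed it. In the rainbow case the
    non-exhausted terms use distinct colours still alive at [t] in palettes up to [i0]: at most [b]
    in each earlier palette and [#|A|] in [i0]. *)
Lemma exhausted_of_mono_or_rainbow :
    (forall j j', palette_color (e j) = palette_color (e j')) \/
    injective (fun j => palette_color (e j)) ->
  #|J| <= #|[set j | exhausted (T0 :\ e j t) t (e j)]| + (m * b + #|A|).
Proof.
case: (safe_palette_le (e j0) t) => i0t i0m _.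
have m0 : 0 < m by apply: leq_ltn_trans i0m.
set Ab := [set j | _].
case=> [mono|rainbow].
  suff -> : Ab = [set: J] by rewrite cardsT leq_addr.
  apply/setP => j; rewrite !inE; apply: contraT => /final_palette_normal le_i0.
  have [c /aliveP[cA H] Ej] := palette_colorP (e j) m0.
  have [j' Ej't] := all_digits c.
  have [c' /aliveP[_ H'] Ej'] := palette_colorP (e j') m0.
  have := mono j j'; rewrite Ej Ej' => -[/(congr1 val)].
  have fin_le j1 : final_palette (e j1) < m.+1.
    by rewrite ltnS -[X in _ <= X](size_iota 0) find_size.
  rewrite /= !inordK // => Efin Ec.
  have le_t : final_palette (e j') * tau <= t < L.
    by rewrite -Efin ltn_ord andbT (leq_trans _ i0t) // leq_mul2r le_i0 orbT.
  by have := H' t le_t; rewrite Ej't Ec eqxx.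
pose Q := \bigcup_(i < i0.+1)
  [set (inord i : 'I_m.+1, Some c) | c in alive i (e j0) t].
have subQ : [set palette_color (e j) | j in ~: Ab] \subset Q.
  apply/subsetP => _ /imsetP[j + ->]; rewrite !inE => /final_palette_normal le_i0.
  have [c cE ->] := palette_colorP (e j) m0.
  apply/bigcupP; exists (inord (final_palette (e j))) => //.
  rewrite inordK //; apply/imsetP; exists c => //.
  by have /subsetP := alive_prefix (final_palette (e j)) j; apply.
have := subset_leq_card subQ; rewrite card_imset // => leQ.
have := cardsC Ab => <-; rewrite leq_add2l; apply: leq_trans leQ _.
apply: (@leq_trans (\sum_(i < i0.+1) #|alive i (e j0) t|)).
  rewrite /Q; elim/big_rec2: _ => [|i y1 y2 _ IH]; first by rewrite cards0.
  apply: leq_trans (leq_card_setU _ _) _; rewrite leq_add //; exact: leq_imset_card.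
rewrite big_ord_recr /= leq_add //; last first.
  by apply: subset_leq_card; apply/subsetP => c /aliveP[].
apply: (@leq_trans (\sum_(i < i0) b)).
  by apply: leq_sum => i _; apply: before_safe_palette.
by rewrite sum_nat_const card_ord leq_mul2r ltnW // orbT.
Qed.

End Terms.
End Palettes.

Local Open Scope ring_scope.

(** * Independence by resampling one coordinate of a random function *)

Section Update.
Variables (V G : finType).
Implicit Types (h : {ffun V -> G}) (v : V) (g : G).

Definition upd h v g : {ffun V -> G} := [ffun w => if w == v then g else h w].

(** Swapping the new value with the old one is an involution on pairs (function, value), so
    resampling a coordinate preserves the uniform measure. *)
Lemma sum_upd (M : nmodType) (f : {ffun V -> G} -> M) v :
  \sum_h \sum_g f (upd h v g) = (\sum_h f h) *+ #|G|.
Proof.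
pose phi (q : {ffun V -> G} * G) := (upd q.1 v q.2, q.1 v).
have phiK : involutive phi.
  move=> [h g]; rewrite /phi /= ffunE eqxx; congr pair.
  by apply/ffunP => w; rewrite !ffunE; case: eqP => // ->.
rewrite pair_big /= (eq_bigr (fun q => f (phi q).1)) //.
have -> : \sum_(q : {ffun V -> G} * G) f (phi q).1 = \sum_(q : {ffun V -> G} * G) f q.1.
  by rewrite [RHS](reindex_inj (inv_inj phiK)).
rewrite -(pair_big predT predT (fun h g => f h)) /= -sumrMnl.
by apply: eq_bigr => h _; rewrite sumr_const.
Qed.

(** Resampling [nd j] leaves the other events unchanged and makes [P j] hold with conditional
    probability at most [beta]; the events are peeled off one at a time. *)
Lemma indep_count (R : realFieldType) (J : eqType) (nd : J -> V)
    (P : J -> pred {ffun V -> G}) (beta : R) (s : seq J) :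
    0 <= beta -> uniq s -> (0 < #|G|)%N ->
    (forall i j h g, i != j -> P i (upd h (nd j) g) = P i h) ->
    (forall j h, \sum_g (P j (upd h (nd j) g))%:R <= beta * #|G|%:R) ->
  \sum_h (all (P^~ h) s)%:R <= beta ^+ size s * #|{ffun V -> G}|%:R.
Proof.
move=> beta0 us G0 Pind Pbeta; elim: s us => [_|j s IH /= /andP[js us]].
  by rewrite expr0 mul1r /= sumr_const.
have G0' : 0 < #|G|%:R :> R by rewrite ltr0n.
rewrite -(ler_pM2r G0') [leLHS]mulr_natr.
rewrite -[leLHS](@sum_upd R (fun h => (P j h && all (P^~ h) s)%:R) (nd j)).
apply: (@le_trans _ _ (\sum_h ((all (P^~ h) s)%:R * (beta * #|G|%:R)))).
  apply: ler_sum => h _.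
  apply: le_trans (ler_wpM2l (ler0n _ _) (Pbeta j h)).
  rewrite mulr_sumr; apply: ler_sum => g _.
  rewrite -natrM mulnb andbC.
  rewrite (@eq_in_all _ (P^~ (upd h (nd j) g)) (P^~ h)) // => i si /=.
  by apply: Pind; apply: contraNneq js => <-.
by rewrite -mulr_suml exprS mulrA ler_pM2r // [leLHS]mulrC -mulrA ler_wpM2l ?IH.
Qed.

End Update.

(** * The probability that random digits cover a given set *)

Section Occupancy.
Variables (R : realFieldType) (I : finType) (Z : finZmodType).

Definition covered (s : seq I) (T : {set Z}) (e : I -> Z) : bool :=
  [forall c in T, has (fun i => e i == c) s].

(** The probability that [n] independent uniform draws from [Z] hit a given element. *)
Definition hit_prob (n : nat) : R := 1 - (1 - #|Z|%:R^-1) ^+ n.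

Lemma cardZ_gt0 : 0 < #|Z|%:R :> R.
Proof. by rewrite ltr0n; apply/card_gt0P; exists 0. Qed.

Lemma hit_prob01 n : 0 <= hit_prob n <= 1.
Proof.
have Z1 : #|Z|%:R^-1 <= 1 :> R.
  rewrite invf_le1 ?cardZ_gt0 // ler1n; apply/card_gt0P; by exists 0.
have Z0 : 0 < #|Z|%:R^-1 :> R by rewrite invr_gt0 cardZ_gt0.
have q0 : 0 <= 1 - #|Z|%:R^-1 :> R by rewrite subr_ge0.
rewrite /hit_prob subr_ge0 exprn_ile1 //=; last lra.
by rewrite gerBl exprn_ge0.
Qed.

Lemma exprDn_ge_linear (x y : R) n : 0 <= x -> 0 <= y ->
  x ^+ n.+1 + n.+1%:R * x ^+ n * y <= (x + y) ^+ n.+1.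
Proof.
move=> x0 y0; elim: n => [|n IH]; first by rewrite expr0 !expr1 mulr1 mul1r.
rewrite [leRHS]exprS; apply: le_trans (ler_wpM2l (addr_ge0 x0 y0) IH).
have := mulr_ge0 (mulr_ge0 (ler0n R n.+1) (exprn_ge0 n x0)) (mulr_ge0 y0 y0).
rewrite -[n.+2%:R]natr1 !exprS; set u := x ^+ n; set m := n.+1%:R; nra.
Qed.

(** Negative correlation, by induction on the draws: one draw either lands in [T], leaving one
    element fewer to cover, or misses it. With r the old hit probability, the resulting average is
    the first two binomial terms of (r + (1 - r)/|Z|)^|T|, and that base is the new hit
    probability. *)
Lemma card_covered (kappa : I -> Z) (s : seq I) (T : {set Z}) : uniq s ->
  \sum_(g : {ffun I -> Z}) (covered s T (fun i => g i + kappa i))%:R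
    <= hit_prob (size s) ^+ #|T| * #|{ffun I -> Z}|%:R.
Proof.
elim: s T => [|i s IH] T.
  move=> _; case: (set_0Vmem T) => [->|[c cT]].
    rewrite cards0 expr0 mul1r -sumr_const; apply: ler_sum => g _.
    by case: (covered _ _ _).
  apply: le_trans (_ : 0 <= _); last first.
    by rewrite mulr_ge0 ?exprn_ge0 ?ler0n //; case/andP: (hit_prob01 0).
  rewrite big1 // => g _; case: (boolP (covered _ _ _)) => // /forall_inP /(_ c cT).
  by [].
move=> /= /andP[i_s us].
rewrite -(ler_pM2r cardZ_gt0) [leLHS]mulr_natr.
rewrite -[leLHS](@sum_upd _ _ R
  (fun g => (covered (i :: s) T (fun j => g j + kappa j))%:R) i).
rewrite exchange_big /=.
set Om := #|{ffun I -> Z}|%:R; set r := hit_prob (size s).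
have [r0 r1] := andP (hit_prob01 (size s)).
have step (c : Z) :
    \sum_(g : {ffun I -> Z}) (covered (i :: s) T (fun j => upd g i c j + kappa j))%:R
      <= r ^+ #|T :\ (c + kappa i)| * Om.
  apply: le_trans (IH _ us); apply: ler_sum => g _; rewrite ler_nat.
  case: (boolP (covered (i :: s) _ _)) => // /forall_inP cov.
  suff -> : covered s (T :\ (c + kappa i)) (fun j => g j + kappa j) by [].
  apply/forall_inP => c'; rewrite in_setD1 => /andP[ne c'T].
  have := cov _ c'T; rewrite /= ffunE eqxx eq_sym (negPf ne) /= => /hasP[j js].
  rewrite ffunE (_ : (j == i) = false); last by apply: contraNF i_s => /eqP<-.
  by move=> ?; apply/hasP; exists j.
apply: le_trans (ler_sum _ (fun c _ => step c)) _.
rewrite -mulr_suml [leRHS]mulrAC ler_wpM2r ?ler0n //.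
rewrite (reindex_inj (addIr (- kappa i))) /=.
under eq_bigr do rewrite subrK.
rewrite (bigID (mem T)) /=.
rewrite (eq_bigr (fun=> r ^+ #|T|.-1)); last first.
  by move=> c cT; rewrite (cardsD1 c T) cT.
rewrite [X in _ + X](eq_bigr (fun=> r ^+ #|T|)); last first.
  move=> c cT; rewrite (_ : T :\ c = T) //; apply/setDidPl.
  by rewrite disjoint_sym disjoints1.
rewrite !sumr_const.
have -> : #|[predC T]| = (#|Z| - #|T|)%N by rewrite -(cardC (mem T)) addKn.
have -> : hit_prob (size s).+1 = r + (1 - r) * #|Z|%:R^-1.
  by rewrite /r /hit_prob exprS; ring.
have zn0 := lt0r_neq0 cardZ_gt0.
have leTZ : (#|T| <= #|Z|)%N by apply: max_card.
case ET: #|T| leTZ => [|n] leTZ /=.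
  by rewrite mulr0n add0r !expr0 subn0 mul1r.
rewrite -[_ *+ n.+1]mulr_natr -[_ *+ (_ - _)]mulr_natr natrB //.
have y0 : 0 <= (1 - r) * #|Z|%:R^-1 by rewrite mulr_ge0 ?invr_ge0 ?ler0n // subr_ge0.
have := ler_wpM2r (ltW cardZ_gt0) (exprDn_ge_linear n r0 y0).
apply: le_trans; rewrite le_eqVlt; apply/orP; left; apply/eqP.
rewrite exprS; field.
exact: zn0.
Qed.

End Occupancy.

Lemma eq_alive (F : finType) (L tau : nat) (A : {set F}) (i n : nat) (e e' : 'I_L -> F) :
  (forall s : 'I_L, (s < n)%N -> e s = e' s) -> alive tau A i e n = alive tau A i e' n.
Proof.
move=> E; apply/setP => c; rewrite !inE; congr andb; apply: eq_forallb => s.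
by case: (boolP (_ <= s < n)%N) => //= /andP[_ /E->].
Qed.

Lemma eq_safe_palette (F : finType) (L tau m b : nat) (A : {set F}) (n : nat)
    (e e' : 'I_L -> F) :
  (forall s : 'I_L, (s < n)%N -> e s = e' s) ->
  safe_palette tau m b A e n = safe_palette tau m b A e' n.
Proof. by move=> E; apply: eq_find => i; rewrite (eq_alive _ _ _ E). Qed.

Lemma eq_exhausted (F : finType) (L : nat) (T : {set F}) (t : nat) (e e' : 'I_L -> F) :
  e =1 e' -> exhausted T t e = exhausted T t e'.
Proof.
by move=> E; apply: eq_forallb => c; congr implb; apply: eq_existsb => s; rewrite E.
Qed.

(** * Randomly shifted digits of a progression *)

Section Relabelling.
Variables (p L : nat).
Hypothesis p_pr : prime p.

Local Notation node_type := ('I_L.+1 * 'I_(p ^ L).-1.+1)%type.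
Local Notation shifts := {ffun 'I_L -> 'F_p}.

(** The level-[r] vertex above [x] in the tree of residues modulo powers of [p]; the second
    component is typed to hold any residue modulo [p ^ L]. *)
Definition node (r x : nat) : node_type := (inord r, inord (x %% p ^ r)).

(** Every vertex carries a whole vector of shifts, and position [s] adds those of all levels up to
    [s]. Thus for each [t] the single vertex at level [t.+1] randomises all positions above [t] at
    once. *)
Definition label (h : {ffun node_type -> shifts}) (x : nat) (s : 'I_L) : 'F_p :=
  (x %/ p ^ s)%:R + \sum_(r < L.+1 | (r <= s)%N) h (node r x) s.

Lemma node_inj r r' x x' : (r <= L)%N -> (r' <= L)%N ->
  node r x = node r' x' -> r = r' /\ x = x' %[mod p ^ r].
Proof.
move=> rL r'L [/(congr1 val) /=]; rewrite !inordK ?ltnS // => <- /(congr1 val) /=.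
have bd y : (y %% p ^ r < (p ^ L).-1.+1)%N.
  rewrite prednK ?expn_gt0 ?prime_gt0 //; apply: leq_trans (ltn_pmod _ _) _.
    by rewrite expn_gt0 prime_gt0.
  by rewrite leq_exp2l // prime_gt1.
by rewrite !inordK.
Qed.

Section Progression.
Variables (x0 d : nat) (t : 'I_L).
Hypotheses (d_gt0 : (0 < d)%N) (td : logn p d = t).

Let x (i : nat) := (x0 + i * d)%N.
Let nd (i : 'I_p) := node t.+1 (x i).

Let dE : d = (d %/ p ^ t * p ^ t)%N.
Proof. by rewrite divnK // -td pfactor_dvdnn. Qed.

Let p_ndvd : ~~ (p %| d %/ p ^ t)%N.
Proof.
apply/negP => h; have : (p ^ t.+1 %| d)%N by rewrite dE expnS dvdn_mul.
by rewrite pfactor_dvdn // td ltnn.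
Qed.

Lemma ap_mod_lt r i : (r <= t)%N -> x i = x0 %[mod p ^ r].
Proof.
move=> rt; have /eqP dv : (p ^ r %| i * d)%N.
  by rewrite dvdn_mull // (dvdn_trans (dvdn_exp2l p rt)) // -td pfactor_dvdnn.
by rewrite /x -modnDmr dv addn0.
Qed.

Lemma ap_div (s : nat) i : (s <= t)%N ->
  (x i %/ p ^ s = x0 %/ p ^ s + i * (d %/ p ^ t) * p ^ (t - s))%N.
Proof.
move=> st; rewrite /x; move: dE; set u := (d %/ p ^ t)%N => ->.
have -> : (i * (u * p ^ t) = i * u * p ^ (t - s) * p ^ s)%N.
  by rewrite -[RHS]mulnA -expnD subnK // mulnA.
by rewrite addnC divnMDl ?expn_gt0 ?prime_gt0 // addnC.
Qed.

(** This makes the level-[t.+1] vertices of the [p] terms distinct, hence their shifts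
    independent. *)
Lemma ap_mod_inj (i j : 'I_p) : x i = x j %[mod p ^ t.+1] -> i = j.
Proof.
wlog le_ij : i j / (i <= j)%N => [W|].
  by move=> E; case/orP: (leq_total i j) => ?; [|apply/esym]; apply: W.
move=> E; apply/val_inj/eqP; rewrite eqn_leq le_ij /= leqNgt; apply/negP => lt.
have : (p ^ t.+1 %| x j - x i)%N.
  by rewrite -eqn_mod_dvd ?E // leq_add2l leq_mul2r le_ij orbT.
rewrite /x subnDl -mulnBl {1}dE mulnA expnS dvdn_pmul2r ?expn_gt0 ?prime_gt0 //.
rewrite Euclid_dvdM // (negPf p_ndvd) orbF gtnNdvd ?subn_gt0 //.
by apply: leq_ltn_trans (leq_subr _ _) (ltn_ord j).
Qed.

Lemma label_low h i (s : 'I_L) : (s < t)%N -> label h (x i) s = label h x0 s.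
Proof.
move=> st; rewrite /label ap_div 1?ltnW // natrD natrM; congr (_ + _).
  rewrite natrX pchar_Fp_0 // expr0n subn_eq0 leqNgt st mulr0 addr0 //.
apply: eq_bigr => r rs; rewrite /node ap_mod_lt //.
exact: ltnW (leq_ltn_trans rs st).
Qed.

(** The shifts used at position [t] are common to all terms, so this label is affine in [i] with
    slope [d %/ p ^ t], a unit modulo [p]. *)
Lemma label_digit h c : exists i : 'I_p, label h (x i) t = c.
Proof.
have d0 : (d %/ p ^ t)%:R != 0 :> 'F_p.
  by rewrite -(dvdn_pcharf (pchar_Fp p_pr)).
pose z : 'F_p := (c - label h x0 t) / (d %/ p ^ t)%:R.
have zp : (z < p)%N by rewrite -[X in (_ < X)%N](Fp_cast p_pr) ltn_ord.
have zE : (Ordinal zp : nat)%:R = z by exact: natr_Zp.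
exists (Ordinal zp).
have -> : label h (x (Ordinal zp)) t = label h x0 t + z * (d %/ p ^ t)%:R.
  rewrite /label ap_div // subnn muln1 natrD natrM zE addrAC; congr (_ + _ + _).
  by apply: eq_bigr => r rt; rewrite /node ap_mod_lt.
by rewrite /z divfK // addrC subrK.
Qed.

Lemma label_upd_low h g (i : nat) (j : 'I_p) (s : 'I_L) : (s <= t)%N ->
  label (upd h (nd j) g) (x i) s = label h (x i) s.
Proof.
move=> st; rewrite /label; congr (_ + _); apply: eq_bigr => r rs.
rewrite ffunE; case: eqP => // /node_inj[]; rewrite ?ltn_ord //; first by rewrite -ltnS ltn_ord.
by move=> Er; move: rs; rewrite Er ltnNge st.
Qed.

Lemma label_upd_other h g (i j : 'I_p) : i != j ->
  label (upd h (nd j) g) (x i) =1 label h (x i).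
Proof.
move=> ij s; rewrite /label; congr (_ + _); apply: eq_bigr => r rs.
rewrite ffunE; case: eqP => // /node_inj[]; rewrite ?ltn_ord //; first by rewrite -ltnS ltn_ord.
by move=> -> /ap_mod_inj Eij; rewrite Eij eqxx in ij.
Qed.

Lemma label_upd_high h (j : 'I_p) : exists kappa : 'I_L -> 'F_p,
  forall g (s : 'I_L), (t < s)%N -> label (upd h (nd j) g) (x j) s = g s + kappa s.
Proof.
have tL : (t.+1 < L.+1)%N by rewrite ltnS ltn_ord.
exists (fun s : 'I_L => (x j %/ p ^ s)%:R +
  \sum_(r < L.+1 | (r <= s)%N && (r != Ordinal tL)) h (node r (x j)) s) => g s ts.
rewrite /label (bigD1 (Ordinal tL)) //= ffunE eqxx addrCA; congr (_ + (_ + _)).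
apply: eq_bigr => r /andP[rs rt]; rewrite ffunE; case: eqP => // /node_inj[] //.
  by rewrite -ltnS ltn_ord.
by move=> Er; case/eqP: rt; apply: val_inj.
Qed.

Variables (R : realFieldType) (tau m b : nat) (A : {set 'F_p}).
Hypotheses (L_le : (L <= m * tau)%N) (tau_A : (tau + b < #|A|)%N).

(** The reference palette is read from [x0], whose labels below [t] all terms share; resampling the
    vertices [nd j] therefore does not change it. *)
Definition abnormal (h : {ffun node_type -> shifts}) (i : 'I_p) : bool :=
  let w := label h x0 in
  exhausted (alive tau A (safe_palette tau m b A w t) w t :\ label h (x i) t) t
    (label h (x i)).

Local Notation beta := (hit_prob R 'F_p L ^+ b).

(** Resampling [nd j] affects only term [j], whose labels above [t] become uniform, while the set to
    be covered stays fixed with at least [b] elements. *)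
Lemma sum_abnormal (B : {set 'I_p}) :
  \sum_h [forall i in B, abnormal h i]%:R
    <= beta ^+ #|B| * #|{ffun node_type -> shifts}|%:R.
Proof.
have [r0 r1] := andP (hit_prob01 R 'F_p L).
have T0E h g j :
    alive tau A (safe_palette tau m b A (label (upd h (nd j) g) x0) t)
      (label (upd h (nd j) g) x0) t
    = alive tau A (safe_palette tau m b A (label h x0) t) (label h x0) t.
  have E (s : 'I_L) : (s < t)%N -> label (upd h (nd j) g) x0 s = label h x0 s.
    move=> st; rewrite -(label_low _ 0 st) -(label_low h 0 st) label_upd_low //.
    exact: ltnW.
  by rewrite (eq_safe_palette _ _ _ _ E) (eq_alive _ _ _ E).
have -> : \sum_h [forall i in B, abnormal h i]%:R =
    \sum_h (all (fun i => abnormal h i) (enum B))%:R :> R.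
  apply: eq_bigr => h _; congr (_%:R); congr nat_of_bool.
  by apply/forall_inP/allP => H i; [rewrite mem_enum => /H |
    move=> iB; apply: H; rewrite mem_enum].
rewrite cardE; apply: (@indep_count _ _ R 'I_p nd (fun i h => abnormal h i)).
- by rewrite exprn_ge0.
- exact: enum_uniq.
- by apply/card_gt0P; exists [ffun=> 0].
- move=> i j h g ij; rewrite /abnormal T0E label_upd_low //.
  by apply: eq_exhausted; apply: label_upd_other.
move=> j h; have [kappa Ek] := label_upd_high h j.
set T := alive tau A (safe_palette tau m b A (label h x0) t) (label h x0) t :\ label h (x j) t.
have bT : (b <= #|T|)%N.
  have [_ _] := safe_palette_le L_le tau_A (label h x0) t.
  by rewrite (cardsD1 (label h (x j) t)) -/T; case: (_ \in _);
    [rewrite add1n ltnS | rewrite add0n => /ltnW].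
apply: le_trans (_ : hit_prob R 'F_p L ^+ #|T| * #|shifts|%:R <= _); last first.
  by rewrite ler_wpM2r ?ler0n // ler_wiXn2l.
(* Covering by the positions above [t] is relaxed to covering by all [L] positions. *)
have := card_covered R kappa T (enum_uniq 'I_L).
rewrite size_enum_ord; apply: le_trans.
apply: ler_sum => g _; rewrite ler_nat /abnormal T0E label_upd_low // -/T.
case: (boolP (exhausted _ _ _)) => // /forall_inP ex.
suff -> : covered (enum 'I_L) T (fun s => g s + kappa s) by [].
apply/forall_inP => c /ex /existsP[s /andP[ts /eqP Es]].
by apply/hasP; exists s; rewrite ?mem_enum // -Ek // Es.
Qed.

(** Union bound over the sets of terms that could be the abnormal ones. *)
Lemma sum_many_abnormal q :
  \sum_h (q <= #|[set i | abnormal h i]|)%N%:R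
    <= (2 ^ p)%:R * beta ^+ q * #|{ffun node_type -> shifts}|%:R.
Proof.
have [r0 r1] := andP (hit_prob01 R 'F_p L).
apply: (@le_trans _ _ (\sum_(B : {set 'I_p} | (q <= #|B|)%N)
    \sum_h [forall i in B, abnormal h i]%:R)).
  rewrite exchange_big /=; apply: ler_sum => h _.
  case: (boolP (q <= _)%N) => [le_q|_]; last by apply: sumr_ge0 => *; apply: ler0n.
  rewrite (bigD1 [set i | abnormal h i]) //=.
  have -> : [forall i in [set i | abnormal h i], abnormal h i].
    by apply/forall_inP => i; rewrite inE.
  by rewrite lerDl; apply: sumr_ge0 => *; apply: ler0n.
apply: (@le_trans _ _ (\sum_(B : {set 'I_p}) (beta ^+ q * #|{ffun node_type -> shifts}|%:R))).
  rewrite big_mkcond /=; apply: ler_sum => B _; case: ifP => [qB|_].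
    apply: le_trans (sum_abnormal B) _; rewrite ler_wpM2r ?ler0n //.
    by rewrite ler_wiXn2l ?exprn_ge0 ?exprn_ile1.
  by rewrite mulr_ge0 ?ler0n ?exprn_ge0.
have cS : #|{: {set 'I_p}}| = (2 ^ p)%N.
  by rewrite -(cardsT {set 'I_p}) -powersetT card_powerset cardsT card_ord.
by rewrite sumr_const cS -[_ *+ (2 ^ p)]mulr_natl mulrA.
Qed.

End Progression.

Lemma exists_good_label (R : realFieldType) (tau m b q : nat) (A : {set 'F_p}) :
    (L <= m * tau)%N -> (tau + b < #|A|)%N ->
    (p ^ L * p ^ L * L)%:R * ((2 ^ p)%:R * (hit_prob R 'F_p L ^+ b) ^+ q) < 1 ->
  exists h, forall (x0 d : nat) (t : 'I_L),
    (x0 < p ^ L)%N -> (0 < d < p ^ L)%N -> logn p d = t ->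
    (#|[set i : 'I_p | abnormal x0 d t tau m b A h i]| < q)%N.
Proof.
move=> L_le tau_A small.
(* The valuation [t] is kept as a separate index of the union bound, at the price of a factor
   [L]. *)
pose bad h (w : 'I_(p ^ L) * 'I_(p ^ L) * 'I_L) : bool :=
  let: (x0, d, t) := w in [&& (0 < d)%N, logn p d == t &
    (q <= #|[set i : 'I_p | abnormal x0 d t tau m b A h i]|)%N].
have [/existsP[h /forallP good]|/existsPn all_bad] :=
    boolP [exists h : {ffun node_type -> shifts}, forall w, ~~ bad h w].
  exists h => x0 d t x0N /andP[d0 dN] td.
  have := good (Ordinal x0N, Ordinal dN, t).
  by rewrite /bad /= d0 td eqxx /= -ltnNge.
exfalso; move: small; apply/negP; rewrite -leNgt.
set Om := #|{ffun node_type -> shifts}|%:R : R.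
have Om0 : 0 < Om by rewrite ltr0n; apply/card_gt0P; exists [ffun=> [ffun=> 0]].
rewrite -(ler_pM2r Om0) mul1r.
apply: (@le_trans _ _ (\sum_(h : {ffun node_type -> shifts}) \sum_w (bad h w)%:R)).
  rewrite /Om -sumr_const; apply: ler_sum => h _.
  have /forallPn[w] := all_bad h; rewrite negbK => bw.
  by rewrite (bigD1 w) //= bw lerDl; apply: sumr_ge0 => *; apply: ler0n.
rewrite exchange_big /=.
apply: (@le_trans _ _ (\sum_(w : 'I_(p ^ L) * 'I_(p ^ L) * 'I_L)
    ((2 ^ p)%:R * (hit_prob R 'F_p L ^+ b) ^+ q * Om))); last first.
  by rewrite sumr_const !card_prod !card_ord -[leLHS]mulr_natl mulrA.
apply: ler_sum => -[[x0 d] t] _ /=.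
case: (boolP ((0 < d)%N && (logn p d == t))) => [/andP[d0 /eqP td]|no].
  under eq_bigr do rewrite d0 td eqxx /=.
  exact: sum_many_abnormal.
rewrite big1 => [|h _]; last by rewrite andbA (negPf no).
have [r0 _] := andP (hit_prob01 R 'F_p L).
by rewrite !mulr_ge0 ?ler0n ?exprn_ge0.
Qed.

Lemma no_mono_no_rainbow (R : realFieldType) (tau m b : nat) (A : {set 'F_p}) :
    (L <= m * tau)%N -> (tau + b < #|A|)%N ->
    (p ^ L * p ^ L * L)%:R *
      ((2 ^ p)%:R * (hit_prob R 'F_p L ^+ b) ^+ (p - (m * b + #|A|))) < 1 ->
  exists c : nat -> 'I_m.+1 * option 'F_p,
    forall x0 d, (0 < d)%N -> (x0 + p.-1 * d < p ^ L)%N ->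
      ~ (forall i j : 'I_p, c (x0 + i * d)%N = c (x0 + j * d)%N) /\
      ~ injective (fun i : 'I_p => c (x0 + i * d)%N).
Proof.
move=> L_le tau_A /(exists_good_label L_le tau_A)[h good].
exists (fun x => palette_color tau m A (label h x)) => x0 d d0 lt.
have p1 := prime_gt1 p_pr.
have dN : (d < p ^ L)%N by apply: leq_ltn_trans lt; case: (p) p1 => [|[]] //= ? _; lia.
have tL : (logn p d < L)%N.
  rewrite ltnNge; apply/negP => le_L.
  by have := dvdn_leq d0 (pfactor_dvdnn p d); have := leq_pexp2l (ltnW p1) le_L; lia.
have := good x0 d (Ordinal tL); rewrite d0 dN => /(_ _ isT erefl).
move=> /(_ (leq_ltn_trans (leq_addr _ _) lt)) few.
pose t := Ordinal tL; pose e (i : 'I_p) := label h (x0 + i * d).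
have i0 : 'I_p := Ordinal (ltnW p1).
suff H : ~ ((forall i j : 'I_p, palette_color tau m A (e i) = palette_color tau m A (e j))
    \/ injective (fun i => palette_color tau m A (e i))).
  by split=> ?; apply: H; [left|right].
move=> H.
have low i (s : 'I_L) : (s < t)%N -> e i s = label h x0 s.
  exact: (label_low x0 (erefl : logn p d = t)).
have same j j' (s : 'I_L) : (s < t)%N -> e j s = e j' s.
  by move=> st; rewrite !low.
have := exhausted_of_mono_or_rainbow L_le tau_A i0 same
  (label_digit x0 d0 (erefl : logn p d = t) h) H.
rewrite card_ord; set S := [set j | _].
have -> : S = [set i | abnormal x0 d t tau m b A h i].
  apply/setP => i; rewrite !inE /abnormal.
  by rewrite (eq_safe_palette _ _ _ _ (low i0)) (eq_alive _ _ _ (low i0)).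
move=> le_p; move: few; rewrite -/t ltnNge => /negP; apply.
by rewrite leq_subLR addnC.
Qed.

End Relabelling.

(** * Numerical estimates for the union bound *)

Lemma bernoulli_sub (R : realFieldType) (y : R) n :
  0 <= y <= 1 -> 1 - n%:R * y <= (1 - y) ^+ n.
Proof.
move=> /andP[y0 y1]; elim: n => [|n IH]; first by rewrite mul0r subr0 expr0.
have y1' : 0 <= 1 - y by rewrite subr_ge0.
rewrite exprS; apply: le_trans (ler_wpM2l y1' IH).
have := mulr_ge0 (ler0n R n) (mulr_ge0 y0 y0); rewrite -natr1.
set u := n%:R; nra.
Qed.

Lemma bernoulli_add (R : realFieldType) (y : R) n :
  0 <= y -> 1 + n%:R * y <= (1 + y) ^+ n.
Proof.
move=> y0; elim: n => [|n IH]; first by rewrite mul0r addr0 expr0.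
have y1' : 0 <= 1 + y by rewrite addr_ge0.
rewrite exprS; apply: le_trans (ler_wpM2l y1' IH).
have := mulr_ge0 (ler0n R n) (mulr_ge0 y0 y0); rewrite -natr1.
set u := n%:R; nra.
Qed.

(** With y = 1 - x, x(1 + y) <= 1, so x^D is at most 1/(1 + Dy). *)
Lemma exists_pow_le_half (R : archiRealFieldType) (x : R) :
  0 <= x < 1 -> exists D, x ^+ D <= 2^-1.
Proof.
move=> /andP[x0 x1]; pose y := 1 - x.
have y0 : 0 < y by rewrite subr_gt0.
have := archi_boundP (ltW (_ : 0 < y^-1)); rewrite invr_gt0 => /(_ y0).
set D := Num.bound _ => hD; exists D.
have Dy : 1 <= D%:R * y by rewrite -ler_pdivrMr // mul1r ltW.
have h1 := bernoulli_add D (ltW y0).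
have h2 : (x * (1 + y)) ^+ D <= 1.
  apply: exprn_ile1; first by rewrite mulr_ge0 // addr_ge0 // ltW.
  have -> : x * (1 + y) = 1 - y ^+ 2 by rewrite /y; ring.
  by rewrite gerBl sqr_ge0.
rewrite exprMn in h2.
have := exprn_ge0 D x0; move: (x ^+ D) ((1 + y) ^+ D) h1 h2 => u v; nra.
Qed.

Lemma linear_le_exp2 (K l : nat) : (4 * K + 2 <= l)%N -> (K * l.+1 <= 2 ^ l)%N.
Proof.
move=> Kl; have hl := odd_double_half l; set v := l./2 in hl.
have h1 := ltn_expl v (isT : (1 < 2)%N).
have h2 : (2 ^ v * 2 ^ v <= 2 ^ l)%N by rewrite -expnD leq_exp2l //; lia.
move: (2 ^ l)%N (2 ^ v)%N h1 h2 => a w h1 h2.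
have : (2 * K <= v)%N by lia.
have : (l.+1 <= 2 * v.+1)%N by lia.
nia.
Qed.

Lemma exp_beats_poly (R : archiRealFieldType) (x : R) (n w : nat) :
    0 <= x < 1 -> (0 < w)%N ->
  exists M, forall p, (M <= p)%N -> p%:R ^+ n * x ^+ (p %/ w) < 1.
Proof.
move=> x01 w0; have [D hD] := exists_pow_le_half x01.
have [x0 x1] := andP x01.
pose K := (n.+1 * (w * D.+1))%N; exists (2 ^ (4 * K + 2))%N => p Mp.
have p0 : (0 < p)%N by apply: leq_trans Mp; rewrite expn_gt0.
have l_big : (4 * K + 2 <= trunc_log 2 p)%N by apply: trunc_log_max.
have [l1 l2] := andP (trunc_log_bounds (isT : (1 < 2)%N) p0).
set l := trunc_log 2 p in l_big l1 l2.
have := leq_trans (linear_le_exp2 l_big) l1; rewrite /K => Kp.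
(* Since p < 2^(l+1), the factor p^n stays below 2^u, while [D] factors of x halve the product and
   at least uD are present. *)
set B := (p %/ w)%N; set u := (n.+1 * l.+1)%N.
have uB : (u * D <= B)%N.
  by rewrite leq_divRL //; apply: leq_trans Kp; rewrite /u; nia.
have xB : x ^+ B <= 2^-1 ^+ u.
  apply: (@le_trans _ _ (x ^+ (u * D))); first by rewrite ler_wiXn2l // ltW.
  by rewrite mulnC exprM lerXn2r ?nnegrE ?exprn_ge0 // invr_ge0.
have pn : p%:R ^+ n < 2 ^+ u :> R.
  rewrite -!natrX ltr_nat.
  apply: (@leq_ltn_trans ((2 ^ l.+1) ^ n)); first
    by case: (n) => // n'; rewrite leq_exp2r // ltnW.
  by rewrite -expnM ltn_exp2l // /u; lia.
apply: le_lt_trans (ler_wpM2l (exprn_ge0 _ (ler0n _ _)) xB) _.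
by rewrite exprVn ltr_pdivrMr ?mul1r // exprn_gt0.
Qed.

(** By Bernoulli, about p/2 draws miss a given element with probability at least 1/2; 96 blocks of
    [p %/ 2] draws contain 32p draws, the worst case being p = 3. *)
Lemma hit_prob_le (R : realFieldType) p L : prime p -> (L <= 32 * p)%N ->
  hit_prob R 'F_p L <= 1 - 2^-1 ^+ 96.
Proof.
move=> pp Lp; have p1 := prime_gt1 pp.
rewrite /hit_prob card_Fp // lerD2l lerN2; set y := p%:R^-1.
have p0 : 0 < p%:R :> R by rewrite ltr0n ltnW.
have y01 : 0 <= y <= 1.
  by rewrite invr_ge0 ltW // invf_le1 // ler1n ltnW.
have [y0 y1] := andP y01.
set h := (p %/ 2)%N.
have hy : h%:R * y <= 2^-1.
  rewrite ler_pdivrMr // ler_pdivlMl // -natrM ler_nat mulnC; exact: leq_divM.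
have half : 2^-1 <= (1 - y) ^+ h.
  by apply: le_trans (bernoulli_sub h y01); lra.
apply: (@le_trans _ _ ((1 - y) ^+ (h * 96))).
  by rewrite exprM lerXn2r ?nnegrE ?exprn_ge0 ?subr_ge0 ?invr_ge0.
rewrite ler_wiXn2l ?subr_ge0 // ?gerBl //.
have := ltn_ceil p (isT : (0 < 2)%N); rewrite -/h; lia.
Qed.

Lemma union_bound_small (R : archiRealFieldType) : exists M, forall p L q,
    prime p -> (M <= p)%N -> (L <= 32 * p)%N -> (p <= 2 * q)%N ->
  (p ^ L * p ^ L * L)%:R *
    ((2 ^ p)%:R * (hit_prob R 'F_p L ^+ (p %/ 2000)) ^+ q) < 1 :> R.
Proof.
pose x : R := 1 - 2^-1 ^+ 96.
have c0 : 0 < 2^-1 ^+ 96 :> R by rewrite exprn_gt0 // invr_gt0.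
have c1 : 2^-1 ^+ 96 <= 1 :> R by apply: exprn_ile1; lra.
have x01 : 0 <= x < 1 by rewrite /x subr_ge0 c1 gtrBl.
have [x0 x1] := andP x01.
have [M HM] := exp_beats_poly 194 x01 (isT : (0 < 2000)%N).
exists M => p L q pp Mp Lp pq; have p1 := prime_gt1 pp.
have rho_x := hit_prob_le R pp Lp; have [rho0 _] := andP (hit_prob01 R 'F_p L).
set b := (p %/ 2000)%N.
(* The exponent 97p bounds 3L + p, from L <= 32p, L <= p^L and 2 <= p. *)
pose Y : R := p%:R ^+ (97 * p) * x ^+ (b * q).
have Y0 : 0 <= Y by rewrite mulr_ge0 ?exprn_ge0.
apply: (@le_lt_trans _ _ Y).
  rewrite mulrA -natrM; apply: ler_pM; rewrite ?ler0n ?exprn_ge0 //.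
    rewrite -natrX ler_nat.
    apply: (@leq_trans (p ^ L * p ^ L * p ^ L * p ^ p)).
      apply: leq_mul; last by rewrite leq_exp2r ?(ltnW p1).
      by apply: leq_mul => //; rewrite ltnW // ltn_expl.
    by rewrite -!expnD leq_exp2l //; lia.
  by rewrite -exprM lerXn2r ?nnegrE.
(* Squaring turns p <= 2q into a p-th power of one quantity below 1. *)
rewrite -(expr_lt1 (isT : (0 < 2)%N)) // /Y exprMn -!exprM.
apply: (@le_lt_trans _ _ ((p%:R ^+ 194 * x ^+ b) ^+ p)).
  rewrite exprMn -!exprM; apply: ler_pM; rewrite ?exprn_ge0 //.
    by rewrite (_ : (97 * p * 2 = 194 * p)%N) //; lia.
  by rewrite ler_wiXn2l ?(ltW x1) // -mulnA leq_mul2l; apply/orP; right; lia.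
rewrite expr_lt1 ?HM ?mulr_ge0 ?exprn_ge0 //; exact: ltnW.
Qed.

(** * Choice of parameters and the final bound *)

Lemma canonical_ramsey_gt : exists k0, forall k N : nat, (k0 <= k)%N ->
  canonical_ramsey k N -> (k ^ (2 * k) < N)%N.
Proof.
have [M HM] := union_bound_small rat.
pose l0 := maxn 16 (8 * (M + 4000))%N.
exists (2 ^ l0)%N => k N k0k ramsey; rewrite ltnNge; apply/negP => N_le.
have k_log : (l0 <= trunc_log 2 k)%N by apply: trunc_log_max.
have [p pp /andP[pk kp]] := exists_prime_between (leq_trans (leq_maxl _ _) k_log).
have p_big : (M + 4000 <= p)%N.
  have := ltn_expl l0 (isT : (1 < 2)%N); have := leq_maxr 16 (8 * (M + 4000)).
  rewrite -/l0; lia.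
have p1 := prime_gt1 pp.
set L := (4 * k)%N; set b := (p %/ 2000)%N; set a := (p %/ 4)%N.
have [A cA] : exists A : {set 'F_p}, #|A| = a.
  have : (a <= #|'F_p|)%N by rewrite card_Fp // leq_div.
  case/card_geqP => s [us <- _]; exists [set c in s].
  by rewrite cardsE; apply/card_uniqP.
(* There are m = 288 palettes of spacing about p/8, enough for L < 32p; then m b + |A| is at most
   288p/2000 + p/4 < p/2, which leaves q >= p/2. *)
have h_tau : (L <= 288 * (p %/ 8))%N.
  by have := ltn_ceil p (isT : (0 < 8)%N); rewrite /L; lia.
have b_le : (2000 * b <= p)%N by rewrite mulnC leq_divM.
have a_le : (4 * a <= p)%N by rewrite mulnC leq_divM.
have h_A : (p %/ 8 + b < #|A|)%N.
  have := ltn_ceil p (isT : (0 < 4)%N); have := leq_divM p 8.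
  by rewrite cA -/a; lia.
have [|c Hc] := no_mono_no_rainbow (R := rat) pp h_tau h_A.
  by apply: HM => //; rewrite ?cA /L; lia.
(* The predecessor moves [N] to start at 0. Only the first [p] terms of the k-term progression are
   used below; they inherit being monochromatic or rainbow. *)
have [a0 [d [[d0 ap_in_N] mr]]] := ramsey _ (fun x => c x.-1).
have k_gt0 : (0 < k)%N by lia.
have a0_gt0 : (0 < a0)%N.
  by have /andP[+ _] := ap_in_N (Ordinal k_gt0); rewrite mul0n addn0.
have last_lt : (p.-1 < k)%N by lia.
have [|mono rainbow] := Hc a0.-1 d d0.
  have /andP[_ le_N] := ap_in_N (Ordinal last_lt).
  have N_pL : (N <= p ^ L)%N.
    (* Here k < 8p <= p^2, so k^(2k) <= p^(4k). *)
    apply: leq_trans N_le _; rewrite /L (_ : 4 * k = 2 * (2 * k))%N; last by lia.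
    rewrite [leqRHS]expnM leq_exp2r; last by lia.
    by rewrite expnS expn1; nia.
  move: le_N N_pL a0_gt0 => /=; move: (p.-1 * d)%N (p ^ L)%N => u v; lia.
have termE (i : 'I_p) : (a0.-1 + i * d = (a0 + (widen_ord pk i) * d).-1)%N.
  by rewrite /=; case: (a0) a0_gt0.
case: mr => [mono'|rainbow'].
  by apply: mono => i j; rewrite !termE; apply: mono'.
apply: rainbow => i j; rewrite !termE => /rainbow' /(congr1 val) /= E.
exact: val_inj.
Qed.

From mathcomp Require Import all_classical all_reals all_analysis.

Import numFieldNormedType.Exports.

Local Open Scope classical_set_scope.
Local Open Scope ring_scope.

Lemma inv_expR1_le_ln (R : realType) (k : nat) : (2 <= k)%N ->
  (expR 1)^-1 <= ln k%:R :> R.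
Proof.
move=> k2; have k0 : 0 < k%:R :> R by rewrite ltr0n ltnW.
(* The value 1/2 separates the two sides: e >= 2, and exp(1/2) <= 2 <= k. *)
apply: (@le_trans _ _ 2^-1).
  by rewrite lef_pV2 ?posrE ?expR_gt0 //; exact: expR_ge1Dx.
rewrite -ler_expR lnK ?posrE //.
apply: (@le_trans _ _ 2); last by rewrite ler_nat.
have := expR_ge1Dx (- 2^-1 : R); rewrite expRN => h.
rewrite -(invrK (expR _)) -[leRHS]invrK lef_pV2 ?posrE ?invr_gt0 ?expR_gt0 //.
by apply: le_trans h; lra.
Qed.

Theorem theorem1p1 (R : realType) :
  exists (k0 : nat) (eps : nat -> R),
    [/\ (2 <= k0)%N,
        eps =O_\oo (fun k : nat => k%:R `^ (- (475 / 1000)) * ln k%:R),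
        eps k @[k --> \oo] --> (0 : R)
      & forall k N : nat, (k0 <= k)%N -> is_H k N ->
          N%:R `^ (k%:R^-1) / k%:R
            >= ((expR 1)^-1 - eps k) * (k%:R / ln k%:R)].
Proof.
have [k0 Hk0] := canonical_ramsey_gt.
exists (maxn 2 k0), (fun=> 0); split.
- exact: leq_maxl.
- by apply/eqOP; near=> C; apply: nearW => k; rewrite normr0 mulr_ge0.
- exact: cvg_cst.
move=> k N; rewrite geq_max => /andP[k2 k0k] [_ ramsey _].
have lt_N := Hk0 k N k0k ramsey.
have kpos : 0 < k%:R :> R by rewrite ltr0n ltnW.
have le_ln := inv_expR1_le_ln R k2.
have ln_pos : 0 < ln k%:R :> R by apply: lt_le_trans le_ln; rewrite invr_gt0 expR_gt0.
(* Both sides are compared with k: the claimed bound is below k because ln k >= 1/e, and N > k^(2k)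
   gives N^(1/k) >= k^2. *)
apply: (@le_trans _ _ k%:R).
  by rewrite subr0 mulrA ler_pdivrMr // mulrC ler_wpM2l // ltW.
rewrite ler_pdivlMr // -expr2 -powR_mulrn ?ler0n //.
have -> : k%:R `^ 2%:R = (k ^ (2 * k))%:R `^ k%:R^-1 :> R.
  rewrite natrX -powR_mulrn ?ler0n // -powRrM natrM mulfK //; exact: lt0r_neq0.
by rewrite ge0_ler_powR ?invr_ge0 ?nnegrE ?ler0n // ler_nat ltnW.
Unshelve. all: by end_near.
Qed.
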